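(* Suppose $\mathcal{C}$ is an abelian category with an allowable class $E$, and suppose $\mathcal{C}$ has enough $E$-projectives. Then, for objects $X,Y$ of $\mathcal{C}$, $E$-stable equivalence classes of morphisms $X\to Y$ in $\mathcal{C}$ are in bijection with natural transformations of functors \[\mathrm{Ext}^1_{\mathcal{C}/E}(Y,-)\to\mathrm{Ext}^1_{\mathcal{C}/E}(X,-).\] This bijection is natural in $X$ and $Y$.
   Context: An allowable class $E$ in an abelian category $\mathcal{C}$ is a collection of short exact sequences closed under isomorphism of short exact sequences and containing every short exact sequence in which at least one object is zero. An epimorphism $g: M\to N$ is an $E$-epimorphism if $0\to\ker g\to M\to N\to 0$ is in $E$. An object $X$ is $E$-projective if every map $X\to N$ lifts through every $E$-epimorphism $M\to N$. $\mathcal{C}$ has enough $E$-projectives if every object $X$ admits an $E$-epimorphism $P\to X$ with $P$ $E$-projective. Maps $f,g:M\to N$ are $E$-stably equivalent if $f-g$ factors through an $E$-projective object. $\mathrm{Ext}^n_{\mathcal{C}/E}(X,M)$ is the relative Ext group, i.e. the $n$th cohomology of $\mathrm{hom}_{\mathcal{C}}(P_\bullet,M)$, where $\dots\to P_1\xrightarrow{f_1}P_0\xrightarrow{f_0}X\to0$ is an exact sequence with all $P_i$ $E$-projective and each $0\to\ker f_i\to P_i\to\mathrm{im} f_i\to0$ in $E$; it is covariantly functorial in $M$ and contravariantly functorial in $X$. *)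

(* Defs.v *)
From HB Require Import structures.
From mathcomp Require Import all_boot all_algebra generic_quotient ring_quotient.
From mathcomp Require Import boolp.

Set Implicit Arguments.
Unset Strict Implicit.
Unset Printing Implicit Defensive.
Import GRing.Theory.
Local Open Scope ring_scope.
Local Open Scope quotient_scope.

Record preadditive := Preadditive {
  obj :> Type;
  hom : obj -> obj -> zmodType;
  idm : forall X, hom X X;
  comp : forall X Y Z, hom Y Z -> hom X Y -> hom X Z;
  compA : forall X Y Z W (h : hom Z W) (g : hom Y Z) (f : hom X Y),
    comp h (comp g f) = comp (comp h g) f;
  comp1m : forall X Y (f : hom X Y), comp (idm Y) f = f;
  compm1 : forall X Y (f : hom X Y), comp f (idm X) = f;
  compDl : forall X Y Z (g h : hom Y Z) (f : hom X Y),
    comp (g + h) f = comp g f + comp h f;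
  compDr : forall X Y Z (g : hom Y Z) (f h : hom X Y),
    comp g (f + h) = comp g f + comp g h
}.

Arguments hom {C} X Y : rename.
Arguments idm {C} X : rename.
Arguments comp {C X Y Z} g f : rename.

Notation "g \oc f" := (comp g f) (at level 40, left associativity).

Section Preadditive.
Variable C : preadditive.
Implicit Types X Y Z K Q : C.

Definition is_mono X Y (f : hom X Y) :=
  forall T (a b : hom T X), f \oc a = f \oc b -> a = b.

Definition is_epi X Y (f : hom X Y) :=
  forall T (a b : hom Y T), a \oc f = b \oc f -> a = b.

Definition is_zero X :=
  (forall Y (f : hom X Y), f = 0) /\ (forall Y (f : hom Y X), f = 0).

Definition is_kernel X Y K (f : hom X Y) (k : hom K X) :=
  f \oc k = 0 /\
  forall T (t : hom T X), f \oc t = 0 -> exists! s : hom T K, k \oc s = t.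

Definition is_cokernel X Y Q (f : hom X Y) (q : hom Y Q) :=
  q \oc f = 0 /\
  forall T (t : hom Y T), t \oc f = 0 -> exists! s : hom Q T, s \oc q = t.

Definition is_biproduct X Y Z (i1 : hom X Z) (i2 : hom Y Z)
    (p1 : hom Z X) (p2 : hom Z Y) :=
  [/\ p1 \oc i1 = idm X, p2 \oc i2 = idm Y, p1 \oc i2 = 0, p2 \oc i1 = 0
    & i1 \oc p1 + i2 \oc p2 = idm Z].

Record is_abelian : Prop := IsAbelian {
  has_zero : exists Z, is_zero Z;
  has_biproducts : forall X Y, exists Z (i1 : hom X Z) (i2 : hom Y Z)
    (p1 : hom Z X) (p2 : hom Z Y), is_biproduct i1 i2 p1 p2;
  has_kernels : forall X Y (f : hom X Y), exists K (k : hom K X), is_kernel f k;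
  has_cokernels : forall X Y (f : hom X Y),
    exists Q (q : hom Y Q), is_cokernel f q;
  mono_normal : forall X Y (f : hom X Y),
    is_mono f -> exists Q (q : hom Y Q), is_kernel q f;
  epi_normal : forall X Y (f : hom X Y),
    is_epi f -> exists K (k : hom K X), is_cokernel k f
}.

Definition is_image X Y I (f : hom X Y) (m : hom I Y) :=
  exists Q (q : hom Y Q), is_cokernel f q /\ is_kernel q m.

Definition exact_at X Y Z (f : hom X Y) (g : hom Y Z) :=
  exists I (m : hom I Y), is_image f m /\ is_kernel g m.

Definition short_exact X Y Z (i : hom X Y) (p : hom Y Z) :=
  is_kernel p i /\ is_cokernel i p.

Lemma comp0m X Y Z (f : hom X Y) : (0 : hom Y Z) \oc f = 0.
Proof. by apply: (addrI (0 \oc f)); rewrite -compDl !addr0. Qed.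

Lemma compm0 X Y Z (g : hom Y Z) : g \oc (0 : hom X Y) = 0.
Proof. by apply: (addrI (g \oc 0)); rewrite -compDr !addr0. Qed.

Lemma compNm X Y Z (g : hom Y Z) (f : hom X Y) : (- g) \oc f = - (g \oc f).
Proof. by apply: (addrI (g \oc f)); rewrite -compDl !subrr comp0m. Qed.

Lemma compmN X Y Z (g : hom Y Z) (f : hom X Y) : g \oc (- f) = - (g \oc f).
Proof. by apply: (addrI (g \oc f)); rewrite -compDr !subrr compm0. Qed.

Lemma compBl X Y Z (g h : hom Y Z) (f : hom X Y) :
  (g - h) \oc f = g \oc f - h \oc f.
Proof. by rewrite compDl compNm. Qed.

Lemma compBr X Y Z (g : hom Y Z) (f h : hom X Y) :
  g \oc (f - h) = g \oc f - g \oc h.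
Proof. by rewrite compDr compmN. Qed.

Lemma kernel_mono X Y K (f : hom X Y) (k : hom K X) :
  is_kernel f k -> is_mono k.
Proof.
move=> [fk0 univ] T a b kab.
have fka0 : f \oc (k \oc a) = 0 by rewrite compA fk0 comp0m.
have [s [_ us]] := univ _ _ fka0.
by rewrite -(us a erefl) (us b).
Qed.

End Preadditive.

Record abelian := Abelian {
  preadditive_of :> preadditive;
  abelianP : is_abelian preadditive_of
}.

Section ShortExactSequences.
Variable C : preadditive.

Record ses := SES {
  ses_l : C;
  ses_m : C;
  ses_r : C;
  ses_i : hom ses_l ses_m;
  ses_p : hom ses_m ses_r;
  ses_exact : short_exact ses_i ses_p
}.

Definition is_iso (X Y : C) (f : hom X Y) :=
  exists g : hom Y X, g \oc f = idm X /\ f \oc g = idm Y.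

Definition ses_iso (s t : ses) :=
  exists (a : hom (ses_l s) (ses_l t)) (b : hom (ses_m s) (ses_m t))
         (c : hom (ses_r s) (ses_r t)),
    [/\ is_iso a, is_iso b, is_iso c,
        b \oc ses_i s = ses_i t \oc a & c \oc ses_p s = ses_p t \oc b].

End ShortExactSequences.

Record allowable (C : abelian) := Allowable {
  allowed :> ses C -> Prop;
  allowed_iso : forall s t, ses_iso s t -> allowed s -> allowed t;
  allowed_zero : forall s,
    is_zero (ses_l s) \/ is_zero (ses_m s) \/ is_zero (ses_r s) -> allowed s
}.

Section Relative.
Variables (C : abelian) (E : allowable C).
Implicit Types X Y Z K M N P T : C.

Definition in_class X Y Z (i : hom X Y) (p : hom Y Z) :=
  exists h : short_exact i p, E (SES h).

Definition E_epi M N (g : hom M N) :=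
  is_epi g /\ exists K (k : hom K M), is_kernel g k /\ in_class k g.

Definition E_projective X :=
  forall M N (g : hom M N), E_epi g ->
  forall f : hom X N, exists h : hom X M, g \oc h = f.

Definition enough_projectives :=
  forall X, exists P (p : hom P X), E_projective P /\ E_epi p.

Definition factors_projective X Y (f : hom X Y) :=
  exists P (a : hom X P) (b : hom P Y), E_projective P /\ f = b \oc a.

Definition stably_equivalent X Y (f g : hom X Y) := factors_projective (f - g).

Definition stably_zero X Y : {pred hom X Y} :=
  [pred f | `[< factors_projective f >]].

Lemma zero_projective Z : is_zero Z -> E_projective Z.
Proof. by move=> [Z0 _] M N g _ f; exists 0; rewrite compm0 (Z0 _ f). Qed.

Lemma biproduct_projective X Y Z (i1 : hom X Z) (i2 : hom Y Z)
    (p1 : hom Z X) (p2 : hom Z Y) : is_biproduct i1 i2 p1 p2 ->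
  E_projective X -> E_projective Y -> E_projective Z.
Proof.
move=> [_ _ _ _ e] PX PY M N g gE f.
have [h1 e1] := PX _ _ _ gE (f \oc i1).
have [h2 e2] := PY _ _ _ gE (f \oc i2).
exists (h1 \oc p1 + h2 \oc p2).
by rewrite compDr !compA e1 e2 -!compA -compDr e compm1.
Qed.

Fact stably_zero_zmod X Y : zmod_closed (@stably_zero X Y).
Proof.
split=> [|f g].
  have [Z Z0] := has_zero (abelianP C).
  rewrite inE; apply/asboolP; exists Z, 0, 0.
  by split; [exact: zero_projective | rewrite compm0].
rewrite !inE => /asboolP[P [a [b [PP ->]]]] /asboolP[Q [c [d [PQ ->]]]].
have [Z [i1 [i2 [p1 [p2 bZ]]]]] := has_biproducts (abelianP C) P Q.
apply/asboolP; exists Z, (i1 \oc a + i2 \oc c), (b \oc p1 - d \oc p2).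
split; first exact: (biproduct_projective bZ).
case: bZ => e11 e22 e12 e21 _.
rewrite compBl !compDr -!compA (compA p1 i1) (compA p1 i2) (compA p2 i1).
rewrite (compA p2 i2).
by rewrite e11 e22 e12 e21 !comp0m !comp1m !compm0 addr0 add0r.
Qed.

HB.instance Definition _ X Y :=
  GRing.isZmodClosed.Build (hom X Y) (@stably_zero X Y) (stably_zero_zmod X Y).

(* [Quotient.quot I] identifies f and g when f - g is in I. *)
Definition stable_hom X Y : Type := Quotient.quot (@stably_zero X Y).

Definition stable_class X Y (f : hom X Y) : stable_hom X Y :=
  \pi_(Quotient.quot (@stably_zero X Y)) f.

Lemma stable_classP X Y (f g : hom X Y) :
  stable_class f = stable_class g <-> stably_equivalent f g.
Proof.
rewrite /stable_class; split=> [/eqP|fg].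
  by rewrite -Quotient.idealrBE inE => /asboolP.
by apply/eqP; rewrite -Quotient.idealrBE inE; apply/asboolP.
Qed.

(* 0 -> ker f -> X -> im f -> 0 is in E. The kernel, the image and the
   factorization m \oc e of f are unique up to isomorphism and E is closed under
   isomorphism, so it does not matter which ones are used. *)
Definition E_admissible X Y (f : hom X Y) :=
  exists K I (k : hom K X) (e : hom X I) (m : hom I Y),
    [/\ is_kernel f k, is_image f m, f = m \oc e & in_class k e].

(* [res_aug] is the map f_0 and [res_d n] is the map f_(n+1). *)
Record resolution X := Resolution {
  res_obj :> nat -> C;
  res_aug : hom (res_obj 0) X;
  res_d : forall n, hom (res_obj n.+1) (res_obj n);
  res_projective : forall n, E_projective (res_obj n);
  res_epi : is_epi res_aug;
  res_exact0 : exact_at (res_d 0) res_aug;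
  res_exact : forall n, exact_at (res_d n.+1) (res_d n);
  res_aug_admissible : E_admissible res_aug;
  res_d_admissible : forall n, E_admissible (res_d n)
}.

Lemma exact_comp X Y Z (f : hom X Y) (g : hom Y Z) :
  exact_at f g -> g \oc f = 0.
Proof.
move=> [I [m [[Q [q [[qf0 _] [_ uq]]]] [gm0 _]]]].
by have [s [<- _]] := uq _ _ qf0; rewrite compA gm0 comp0m.
Qed.

Lemma res_dd X (P : resolution X) n : res_d P n \oc res_d P n.+1 = 0.
Proof. exact: exact_comp (res_exact P n). Qed.

Lemma res_aug_d X (P : resolution X) : res_aug P \oc res_d P 0 = 0.
Proof. exact: exact_comp (res_exact0 P). Qed.

Lemma kernel_lid X Y K (p : hom X Y) (k : hom K X) : is_kernel p k ->
  forall Z (m : hom Y Z), is_mono m -> is_kernel (m \oc p) k.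
Proof.
move=> [pk0 u] Z m mm; split; first by rewrite -compA pk0 compm0.
by move=> T t mpt0; apply: u; apply: mm; rewrite compA mpt0 compm0.
Qed.

Lemma epi_image X Y (p : hom X Y) : is_epi p -> is_image p (idm Y).
Proof.
move=> pe; have [Q [q cq]] := has_cokernels (abelianP C) p.
have q0 : q = 0 by apply: pe; rewrite comp0m (proj1 cq).
exists Q, q; split=> //; rewrite q0; split; first by rewrite comp0m.
by move=> T t _; exists t; split=> [|s]; rewrite comp1m.
Qed.

Lemma image_epi X Y Z K (p : hom X K) (k : hom K Y) (g : hom Y Z) :
  is_epi p -> is_kernel g k -> is_image (k \oc p) k.
Proof.
move=> pe [gk0 uk].
have [Q [q [qkp0 uq]]] := has_cokernels (abelianP C) (k \oc p).
exists Q, q; split=> //; split.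
  by apply: pe; rewrite -compA qkp0 comp0m.
have gkp0 : g \oc (k \oc p) = 0 by rewrite compA gk0 comp0m.
have [x [<- _]] := uq _ _ gkp0.
by move=> T t qt0; apply: uk; have [y [<- _]] := uq _ _ gkp0;
  rewrite -compA qt0 compm0.
Qed.

Hypothesis enough : enough_projectives.

Lemma resolution_exists X : exists P : resolution X, True.
Proof.
have cover Z : {c : {P : C & hom P Z} &
    {k : {K : C & hom K (tag c)} |
      [/\ E_projective (tag c), is_epi (tagged c),
          is_kernel (tagged c) (tagged k) & in_class (tagged k) (tagged c)]}}.
  have /cid[P /cid[p [PP [pe /cid[K /cid[k [kp kE]]]]]]] := enough Z.
  by exists (Tagged (fun P => hom P Z) p), (Tagged (fun K => hom K P) k).
pose P0 Z := tag (tag (cover Z)).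
pose p Z : hom (P0 Z) Z := tagged (tag (cover Z)).
pose Om Z := tag (sval (tagged (cover Z))).
pose k Z : hom (Om Z) (P0 Z) := tagged (sval (tagged (cover Z))).
have coverP Z : [/\ E_projective (P0 Z), is_epi (p Z), is_kernel (p Z) (k Z)
    & in_class (k Z) (p Z)] by exact: (svalP (tagged (cover Z))).
pose O n := iter n Om X.
unshelve eexists; last by [].
apply: (@Resolution X (fun n => P0 (O n)) (p X)
  (fun n => k (O n) \oc p (O n.+1))).
- by move=> n; case: (coverP (O n)).
- by case: (coverP X).
- have [_ _ kX _] := coverP (O 0); have [_ pe _ _] := coverP (O 1).
  by exists (O 1), (k X); split=> //; apply: image_epi kX.
- move=> n; have [_ _ kn _] := coverP (O n.+1).
  have [_ pe _ _] := coverP (O n.+2); have [_ _ kn' _] := coverP (O n).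
  exists (O n.+2), (k (O n.+1)); split; first by apply: image_epi kn.
  by apply: kernel_lid kn _ _ _; apply: kernel_mono kn'.
- have [_ pe kX kE] := coverP X.
  exists (Om X), X, (k X), (p X), (idm X); split=> //; first exact: epi_image.
  by rewrite comp1m.
- move=> n; have [_ pe kn kE] := coverP (O n.+1).
  have [_ _ kn' _] := coverP (O n).
  exists (Om (O n.+1)), (O n.+1), (k (O n.+1)), (p (O n.+1)), (k (O n)).
  split=> //; last by apply: image_epi kn'.
  by apply: kernel_lid kn _ _ _; apply: kernel_mono kn'.
Qed.

Definition proj_res X : resolution X := sval (cid (resolution_exists X)).

End Relative.

Arguments res_projective {C E X} r n : rename.
Arguments res_epi {C E X} r : rename.

Section Ext.
Variables (C : abelian) (E : allowable C).
Implicit Types (X Y M N : C) (n : nat).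

Definition is_cocycle X (P : resolution E X) M n : {pred hom (P n) M} :=
  [pred a : hom (P n) M | a \oc res_d P n == 0].

Fact is_cocycle_zmod X (P : resolution E X) M n :
  zmod_closed (@is_cocycle X P M n).
Proof.
split=> [|a b]; first by rewrite inE comp0m.
by rewrite !inE => /eqP a0 /eqP b0; rewrite compBl a0 b0 subrr.
Qed.

HB.instance Definition _ X (P : resolution E X) M n :=
  GRing.isZmodClosed.Build (hom (P n) M) (@is_cocycle X P M n)
    (is_cocycle_zmod P M n).

Record cocycle X (P : resolution E X) M n := Cocycle {
  cocycle_val :> hom (P n) M;
  cocycleP : cocycle_val \in @is_cocycle X P M n
}.

HB.instance Definition _ X (P : resolution E X) M n :=
  [isSub for @cocycle_val X P M n].
HB.instance Definition _ X (P : resolution E X) M n :=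
  [Choice of cocycle P M n by <:].
HB.instance Definition _ X (P : resolution E X) M n :=
  [SubChoice_isSubZmodule of cocycle P M n by <:].

Definition coboundary X (P : resolution E X) M n (a : hom (P n) M) : Prop :=
  match n return hom (P n) M -> Prop with
  | 0 => fun a => a = 0
  | n'.+1 => fun a => exists b : hom (P n') M, a = b \oc res_d P n'
  end a.

Definition is_coboundary X (P : resolution E X) M n : {pred cocycle P M n} :=
  [pred a : cocycle P M n | `[< coboundary (cocycle_val a) >]].

Lemma coboundary_zmod X (P : resolution E X) M n :
  coboundary (0 : hom (P n) M) /\
  forall a b : hom (P n) M, coboundary a -> coboundary b -> coboundary (a - b).
Proof.
case: n => [|n] /=; first by split=> // a b -> ->; rewrite subrr.
split; first by exists 0; rewrite comp0m.
by move=> _ _ [a ->] [b ->]; exists (a - b); rewrite compBl.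
Qed.

Fact is_coboundary_zmod X (P : resolution E X) M n :
  zmod_closed (@is_coboundary X P M n).
Proof.
have [b0 bB] := coboundary_zmod P M n.
split=> [|a b]; first by rewrite inE; apply/asboolP.
by rewrite !inE => /asboolP ha /asboolP hb; apply/asboolP/bB.
Qed.

HB.instance Definition _ X (P : resolution E X) M n :=
  GRing.isZmodClosed.Build (cocycle P M n) (@is_coboundary X P M n)
    (is_coboundary_zmod P M n).

Definition cohomology X (P : resolution E X) M n : zmodType :=
  Quotient.quot (@is_coboundary X P M n).

Definition cohomology_class X (P : resolution E X) M n (a : cocycle P M n) :
  cohomology P M n := \pi_(Quotient.quot (@is_coboundary X P M n)) a.

Lemma cohomologyW X (P : resolution E X) M n (K : cohomology P M n -> Prop) :
  (forall a, K (cohomology_class a)) -> forall x, K x.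
Proof. by move=> Ka; elim/quotW. Qed.

End Ext.

Section QuotientMap.
Variables (A B : zmodType) (I : zmodClosed A) (J : zmodClosed B).
Variable phi : {additive A -> B}.

Definition quot_map (x : Quotient.quot I) : Quotient.quot J :=
  \pi_(Quotient.quot J) (phi (repr x)).

Hypothesis phiI : forall a, a \in I -> phi a \in J.

Lemma quot_mapE a :
  quot_map (\pi_(Quotient.quot I) a) = \pi_(Quotient.quot J) (phi a).
Proof.
apply/eqP; rewrite /quot_map -Quotient.idealrBE -raddfB; apply: phiI.
by rewrite Quotient.idealrBE reprK.
Qed.

Lemma quot_map_additive : zmod_morphism quot_map.
Proof.
elim/quotW=> a; elim/quotW=> b.
rewrite -(pi_is_zmod_morphism (Quotient.quot I)) !quot_mapE raddfB.
by rewrite pi_is_zmod_morphism.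
Qed.

Definition quot_hom : {additive Quotient.quot I -> Quotient.quot J} :=
  HB.pack quot_map (GRing.isZmodMorphism.Build _ _ quot_map quot_map_additive).

End QuotientMap.

Section Functors.
Variable C : preadditive.
Implicit Types M N L : C.

Record ab_functor := AbFunctor {
  fobj :> C -> zmodType;
  fmap : forall M N, hom M N -> {additive fobj M -> fobj N};
  fmap_id : forall M (x : fobj M), fmap (idm M) x = x;
  fmap_comp : forall M N L (v : hom N L) (u : hom M N) (x : fobj M),
    fmap (v \oc u) x = fmap v (fmap u x)
}.

Arguments fmap F {M N} u : rename.

Record nat_trans (F G : ab_functor) := NatTrans {
  nt_map :> forall M, {additive F M -> G M};
  nt_natural : forall M N (u : hom M N) (x : F M),
    nt_map N (fmap F u x) = fmap G u (nt_map M x)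
}.

Lemma nat_trans_ext (F G : ab_functor) (s t : nat_trans F G) :
  (forall M (x : F M), s M x = t M x) -> s = t.
Proof.
case: s t => [s sP] [t tP] /= st.
have e : s = t.
  apply: functional_extensionality_dep => M.
  have : (s M : F M -> G M) = t M by apply: funext => x; exact: st.
  case: (s M) (t M) => [f [[cf]]] [g [[cg]]] /= fg.
  by case: g / fg cg => cg; rewrite (Prop_irrelevance cf cg).
by case: t / e sP tP st => sP tP _; rewrite (Prop_irrelevance sP tP).
Qed.

Fact nt_comp_natural (F G H : ab_functor)
    (t : nat_trans G H) (s : nat_trans F G) M N (u : hom M N) (x : F M) :
  (t N \o s N) (fmap F u x) = fmap H u ((t M \o s M) x).
Proof. by rewrite /= !nt_natural. Qed.

Definition nt_comp (F G H : ab_functor)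
    (t : nat_trans G H) (s : nat_trans F G) : nat_trans F H :=
  @NatTrans F H (fun M => t M \o s M) (nt_comp_natural t s).

Lemma nt_compE (F G H : ab_functor) (t : nat_trans G H) (s : nat_trans F G)
  M (x : F M) : nt_comp t s M x = t M (s M x).
Proof. by []. Qed.

End Functors.

Arguments fmap {C} F {M N} u : rename.

Section ExtFunctor.
Variables (C : abelian) (E : allowable C).
Implicit Types (X Y M N L : C) (n : nat).

Section Covariant.
Variables (X : C) (P : resolution E X) (n : nat).

Fact cocycle_post_subproof M N (u : hom M N) (a : cocycle P M n) :
  u \oc a \in @is_cocycle C E X P N n.
Proof. by have := cocycleP a; rewrite !inE -compA => /eqP ->; rewrite compm0. Qed.

Definition cocycle_post M N (u : hom M N) (a : cocycle P M n) :
  cocycle P N n := Cocycle (cocycle_post_subproof u a).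

Fact cocycle_post_additive M N (u : hom M N) :
  zmod_morphism (cocycle_post u).
Proof. by move=> a b; apply: val_inj; rewrite /= compBr. Qed.

HB.instance Definition _ M N (u : hom M N) :=
  GRing.isZmodMorphism.Build (cocycle P M n) (cocycle P N n) (cocycle_post u)
    (cocycle_post_additive u).

Fact cocycle_post_coboundary M N (u : hom M N) (a : cocycle P M n) :
  a \in @is_coboundary C E X P M n ->
  cocycle_post u a \in @is_coboundary C E X P N n.
Proof.
rewrite !inE => /asboolP h; apply/asboolP; case: a h => a _ /=.
case: n a => [|m] a /= => [->|[b ->]]; first by rewrite compm0.
by exists (u \oc b); rewrite compA.
Qed.

Definition cohomology_map M N (u : hom M N) :
    {additive cohomology P M n -> cohomology P N n} :=
  quot_hom (cocycle_post_coboundary u).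

Lemma cohomology_mapE M N (u : hom M N) (a : cocycle P M n) :
  cohomology_map u (cohomology_class a) = cohomology_class (cocycle_post u a).
Proof. exact: (quot_mapE (cocycle_post_coboundary u)). Qed.

Fact cohomology_map_id M (x : cohomology P M n) :
  cohomology_map (idm M) x = x.
Proof.
elim/cohomologyW: x => a; rewrite cohomology_mapE.
by congr cohomology_class; apply: val_inj; rewrite /= comp1m.
Qed.

Fact cohomology_map_comp M N L (v : hom N L) (u : hom M N)
    (x : cohomology P M n) :
  cohomology_map (v \oc u) x = cohomology_map v (cohomology_map u x).
Proof.
elim/cohomologyW: x => a; rewrite !cohomology_mapE.
by congr cohomology_class; apply: val_inj; rewrite /= compA.
Qed.

Definition cohomology_functor : ab_functor C :=
  AbFunctor cohomology_map_id cohomology_map_comp.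

End Covariant.

Record chain_map X Y (P : resolution E X) (Q : resolution E Y) (u : hom X Y) :=
  ChainMap {
    chain :> forall n, hom (P n) (Q n);
    chain_aug : res_aug Q \oc chain 0 = u \oc res_aug P;
    chain_d : forall n, res_d Q n \oc chain n.+1 = chain n \oc res_d P n
  }.

Lemma projective_lift_exact X Y Z T (f : hom X Y) (g : hom Y Z) (t : hom T Y) :
  E_admissible E f -> exact_at f g -> E_projective E T -> g \oc t = 0 ->
  exists s : hom T X, f \oc s = t.
Proof.
move=> [K [I [k [e [m [fk [Q [q [[qf0 uq] [qm0 um]]]] fme ke]]]]]].
move=> [I0 [m0 [[Q0 [q0 [[q0f0 uq0] [q0m0 um0]]]] [gm0 ug]]]] PT gt0.
have [t' [tE _]] := ug _ _ gt0.
have [x [xq _]] := uq0 _ _ qf0.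
have qm00 : q \oc m0 = 0 by rewrite -xq -compA q0m0 compm0.
have [y [yE _]] := um _ _ qm00.
have ee : E_epi E e.
  have [[ek [ke0 ue]] kE] := ke.
  split; last by exists K, k; split=> //; exact: proj1.
  move=> S a b ab; have aek0 : (a \oc e) \oc k = 0 by rewrite -compA ke0 compm0.
  by have [s [_ us]] := ue _ _ aek0; rewrite -(us a erefl) (us b).
have [s sE] := PT _ _ _ ee (y \oc t').
by exists s; rewrite fme -compA sE compA yE tE.
Qed.

Lemma chain_map_exists X Y (P : resolution E X) (Q : resolution E Y)
  (u : hom X Y) : exists phi : chain_map P Q u, True.
Proof.
have [Z Z0] := has_zero (abelianP C).
have augE : exact_at (res_aug Q) (0 : hom Y Z).
  exists Y, (idm Y); split; first exact/epi_image/res_epi.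
  split; first by rewrite comp0m.
  by move=> T t _; exists t; split=> [|s]; rewrite comp1m.
have [a aE] := projective_lift_exact (res_aug_admissible Q) augE
  (res_projective P 0) (comp0m Z (u \oc res_aug P)).
have [|b bE] := projective_lift_exact (t := a \oc res_d P 0)
  (res_d_admissible Q 0) (res_exact0 Q) (res_projective P 1).
  by rewrite compA aE -compA res_aug_d compm0.
pose S n := {c : hom (P n) (Q n) * hom (P n.+1) (Q n.+1) |
  res_d Q n \oc c.2 = c.1 \oc res_d P n}.
have step n (c : hom (P n.+1) (Q n.+1)) (c' : hom (P n) (Q n)) :
    res_d Q n \oc c = c' \oc res_d P n ->
    {d | res_d Q n.+1 \oc d = c \oc res_d P n.+1}.
  move=> cc'; apply: cid.
  apply: (projective_lift_exact (res_d_admissible Q n.+1) (res_exact Q n)).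
    exact: res_projective.
  by rewrite compA cc' -compA res_dd compm0.
pose next n (c : S n) : S n.+1 :=
  exist _ ((sval c).2, sval (step n _ _ (svalP c)))
    (svalP (step n _ _ (svalP c))).
pose F := nat_rect S (exist _ (a, b) bE) next.
by exists (@ChainMap X Y P Q u (fun n => (sval (F n)).1) aE
  (fun n => svalP (F n))).
Qed.

Section Contravariant.
Variables (X Y : C) (P : resolution E X) (Q : resolution E Y) (u : hom X Y).
Variables (phi : chain_map P Q u) (n : nat).

Fact cocycle_pre_subproof M (a : cocycle Q M n) :
  a \oc phi n \in @is_cocycle C E X P M n.
Proof.
have := cocycleP a; rewrite !inE -compA -chain_d compA => /eqP ->.
by rewrite comp0m.
Qed.

Definition cocycle_pre M (a : cocycle Q M n) : cocycle P M n :=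
  Cocycle (cocycle_pre_subproof a).

Fact cocycle_pre_additive M : zmod_morphism (@cocycle_pre M).
Proof. by move=> a b; apply: val_inj; rewrite /= compBl. Qed.

HB.instance Definition _ M :=
  GRing.isZmodMorphism.Build (cocycle Q M n) (cocycle P M n) (@cocycle_pre M)
    (@cocycle_pre_additive M).

Fact cocycle_pre_coboundary M (a : cocycle Q M n) :
  a \in @is_coboundary C E Y Q M n ->
  cocycle_pre a \in @is_coboundary C E X P M n.
Proof.
rewrite !inE => /asboolP h; apply/asboolP; case: a h => a _ /=.
case: n a => [|m] a /= => [->|[b ->]]; first by rewrite comp0m.
by exists (b \oc phi m); rewrite -!compA chain_d.
Qed.

Definition cohomology_pull M :
    {additive cohomology Q M n -> cohomology P M n} :=
  quot_hom (@cocycle_pre_coboundary M).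

Lemma cohomology_pullE M (a : cocycle Q M n) :
  cohomology_pull M (cohomology_class a) = cohomology_class (cocycle_pre a).
Proof. exact: (quot_mapE (@cocycle_pre_coboundary M)). Qed.

Fact cohomology_pull_natural M N (v : hom M N) (x : cohomology Q M n) :
  cohomology_pull N (fmap (cohomology_functor Q n) v x) =
  fmap (cohomology_functor P n) v (cohomology_pull M x).
Proof.
elim/cohomologyW: x => a.
rewrite -[fmap _ _ _]/(cohomology_map Q n v (cohomology_class a)).
rewrite -[RHS]/(cohomology_map P n v (cohomology_pull M (cohomology_class a))).
rewrite cohomology_mapE !cohomology_pullE cohomology_mapE.
by congr cohomology_class; apply: val_inj; rewrite /= compA.
Qed.

Definition cohomology_nat :
    nat_trans (cohomology_functor Q n) (cohomology_functor P n) :=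
  @NatTrans C (cohomology_functor Q n) (cohomology_functor P n)
    cohomology_pull cohomology_pull_natural.

Lemma cohomology_natE M (a : cocycle Q M n) :
  cohomology_nat M (cohomology_class a) = cohomology_class (cocycle_pre a).
Proof. exact: cohomology_pullE. Qed.

End Contravariant.

Lemma chain_homotopy X Y (P : resolution E X) (Q : resolution E Y)
    (u : hom X Y) (phi psi : chain_map P Q u) n :
  exists s : hom (P n) (Q n.+1),
    res_d Q n \oc s \oc res_d P n = (phi n - psi n) \oc res_d P n /\
    forall M (a : hom (Q n) M), a \oc res_d Q n = 0 ->
      coboundary (a \oc (phi n - psi n)).
Proof.
elim: n => [|n [s [sE _]]].
  have [|s sE] := projective_lift_exact (t := phi 0 - psi 0)
    (res_d_admissible Q 0) (res_exact0 Q) (res_projective P 0).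
    by rewrite compBr !chain_aug subrr.
  by exists s; rewrite sE; split=> // M a a0; rewrite -sE compA a0 comp0m.
have [|s' sE'] := projective_lift_exact
    (t := phi n.+1 - psi n.+1 - s \oc res_d P n)
    (res_d_admissible Q n.+1) (res_exact Q n) (res_projective P n.+1).
  by rewrite !compBr !chain_d compA sE compBl subrr.
exists s'; rewrite sE'; split.
  by rewrite compBl -(compA s) res_dd compm0 subr0.
move=> M a a0; exists (a \oc s); rewrite -compA.
by apply/eqP; rewrite -subr_eq0 -compBr -sE' compA a0 comp0m.
Qed.

Lemma cohomology_nat_indep X Y (P : resolution E X) (Q : resolution E Y)
    (u : hom X Y) (phi psi : chain_map P Q u) n :
  cohomology_nat phi n = cohomology_nat psi n.
Proof.
apply: nat_trans_ext => M x; elim/cohomologyW: x => a.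
rewrite !cohomology_natE; apply/eqP; rewrite -Quotient.idealrBE inE.
apply/asboolP; rewrite /= -compBr.
have [_ [_ h]] := chain_homotopy phi psi n.
by apply: h; have := cocycleP a; rewrite inE => /eqP.
Qed.

Variable enough : enough_projectives E.

Definition Ext n X : ab_functor C := cohomology_functor (proj_res enough X) n.

(* The lift is arbitrary, see [cohomology_nat_indep]. *)
Definition Ext_map n X Y (u : hom X Y) : nat_trans (Ext n Y) (Ext n X) :=
  cohomology_nat
    (sval (cid (chain_map_exists (proj_res enough X) (proj_res enough Y) u))) n.

Lemma Ext_map_id n X M (x : Ext n X M) : Ext_map n (idm X) M x = x.
Proof.
pose R := proj_res enough X.
have aug1 : res_aug R \oc idm (R 0) = idm X \oc res_aug R.
  by rewrite compm1 comp1m.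
have d1 m : res_d R m \oc idm (R m.+1) = idm (R m) \oc res_d R m.
  by rewrite compm1 comp1m.
rewrite /Ext_map (cohomology_nat_indep _ (ChainMap aug1 d1)).
elim/cohomologyW: x => a; rewrite cohomology_natE.
by congr cohomology_class; apply: val_inj; rewrite /= compm1.
Qed.

Lemma Ext_map_comp n X Y Z (v : hom Y Z) (u : hom X Y) :
  Ext_map n (v \oc u) = nt_comp (Ext_map n u) (Ext_map n v).
Proof.
rewrite /Ext_map; move: (sval _) (sval _) (sval _) => psi phi chi.
set R := proj_res enough.
have augM : res_aug (R Z) \oc (psi 0 \oc phi 0) = v \oc u \oc res_aug (R X).
  by rewrite -(compA v) -(chain_aug phi) !compA (chain_aug psi).
have dM m : res_d (R Z) m \oc (psi m.+1 \oc phi m.+1) =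
    psi m \oc phi m \oc res_d (R X) m.
  by rewrite -(compA (psi m)) -(chain_d phi) !compA (chain_d psi).
rewrite (cohomology_nat_indep chi (ChainMap augM dM)).
apply: nat_trans_ext => M x; elim/cohomologyW: x => a.
rewrite nt_compE (cohomology_natE psi) (cohomology_natE phi) cohomology_natE.
by congr cohomology_class; apply: val_inj; rewrite /= compA.
Qed.

End ExtFunctor.

(* Main.v *)
From mathcomp Require Import all_boot all_algebra generic_quotient ring_quotient.
From mathcomp Require Import boolp.
Require Import Defs.

(** The bijection sends the class of [f : X -> Y] to the transformation
    [Ext^1(f, -)]; its naturality is functoriality of [Ext] in the first
    variable.

    For bijectivity, let [P] and [Q] be resolutions of [X] and [Y], and let
    [Q_1 -e-> K -k-> Q_0] be the factorization of the first differential of [Q]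
    through the syzygy [K] of [Y], the kernel of [Q_0 -> Y]. Since [e] is the
    cokernel of the next differential, every 1-cocycle is [g \oc e] for some
    [g : K -> M]. So the class of [e] in [Ext^1(Y, K)] generates the functor
    [Ext^1(Y, -)], and a transformation out of it is known from its value there
    ([nat_trans_syzygy]). That value is not arbitrary: pushing [e] along [k]
    gives the differential itself, a coboundary, so the value must die in
    [Ext^1(X, Q_0)]. This produces a map [P_0 -> Q_0], which descends to
    [X -> Y] and realizes the transformation ([cohomology_nat_full]).

    Maps [f] and [g] induce the same transformation exactly when the images of
    the class of [e] agree, that is, when lifts of [f] and [g] to [P_0 -> Q_0]
    can be chosen equal on the syzygy of [X]. This says that [f - g] lifts
    through [Q_0 -> Y] ([cohomology_nat_eq]). As [Q_0 -> Y] is an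
    [E]-epimorphism from an [E]-projective object, such a lift exists if and
    only if [f - g] factors through some [E]-projective object
    ([factors_projectiveP]). *)

Set Implicit Arguments.
Unset Strict Implicit.
Unset Printing Implicit Defensive.
Import GRing.Theory.
Local Open Scope ring_scope.
Local Open Scope quotient_scope.

Section Syzygy.
Variables (C : abelian) (E : allowable C).
Implicit Types X Y Z K M N T W : C.

(** The image of [f] contains the kernel of [g], so whatever vanishes on [f]
    vanishes on every map killed by [g]. *)
Lemma exact_at_kill X Y Z T W (f : hom X Y) (g : hom Y Z) (t : hom T Y)
    (a : hom Y W) :
  exact_at f g -> g \oc t = 0 -> a \oc f = 0 -> a \oc t = 0.
Proof.
move=> [I [m [[Q [q [[_ uq] [qm0 _]]]] [_ um]]]] gt0 af0.
have [s [<- _]] := uq _ _ af0; have [t' [<- _]] := um _ _ gt0.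
by rewrite -compA (compA q) qm0 comp0m compm0.
Qed.

(** An epimorphism is the cokernel of some [c]; exactness places [c] in the image
    of the first differential, which therefore has the same cokernel. *)
Lemma res_aug_cokernel X (P : resolution E X) :
  is_cokernel (res_d P 0) (res_aug P).
Proof.
split=> [|T t td0]; first exact: res_aug_d.
have [K [c [ac0 uc]]] := epi_normal (abelianP C) (res_epi P).
by apply: uc; apply: exact_at_kill (res_exact0 P) ac0 td0.
Qed.

(** Surjectivity onto [Y] is exactness at [Y] of [Q_0 -> Y -> 0], so this is the
    lifting property of exact sequences against the zero map out of [Y]. *)
Lemma res_aug_lift Y (Q : resolution E Y) T (t : hom T Y) :
  E_projective E T -> exists s : hom T (Q 0%N), res_aug Q \oc s = t.
Proof.
move=> PT; have [Z _] := has_zero (abelianP C).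
apply: (projective_lift_exact (g := (0 : hom Y Z)) (res_aug_admissible Q)) => //.
  exists Y, (idm Y); split; first exact/epi_image/res_epi.
  split; first by rewrite comp0m.
  by move=> S s _; exists s; split=> [|s']; rewrite comp1m.
by rewrite comp0m.
Qed.

(** The projective at the start of any resolution of [Y] is universal among
    the projectives through which maps to [Y] may factor. *)
Lemma factors_projectiveP X Y (Q : resolution E Y) (f : hom X Y) :
  factors_projective E f <-> exists t : hom X (Q 0%N), f = res_aug Q \oc t.
Proof.
split=> [[T [a [b [PT ->]]]]|[t ->]].
  by have [s <-] := res_aug_lift Q b PT; exists (s \oc a); rewrite compA.
by exists (Q 0%N), t, (res_aug Q); split=> //; exact: res_projective.
Qed.

Definition is_syzygy Y (Q : resolution E Y) K (k : hom K (Q 0%N))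
    (e : hom (Q 1%N) K) :=
  [/\ is_kernel (res_aug Q) k, is_cokernel (res_d Q 1) e
    & res_d Q 0 = k \oc e].

(** [K] is the image of the first differential. Admissibility only says that
    [e] is the cokernel of some kernel of that differential, and that [k] is the
    kernel of its cokernel; exactness at [Q_1] and at [Q_0] turns these into
    the two universal properties of [is_syzygy]. *)
Lemma syzygy_exists Y (Q : resolution E Y) :
  exists K (k : hom K (Q 0%N)) (e : hom (Q 1%N) K), is_syzygy k e.
Proof.
have [K' [K [k' [e [k [[dk0 _] [R [q [cq kq]]] de [[ke ce] _]]]]]]] :=
  res_d_admissible Q 0.
exists K, k, e; split=> //.
- have [s [sq _]] := proj2 cq _ _ (res_aug_d Q).
  split; first by rewrite -sq -compA (proj1 kq) compm0.
  move=> T t at0; apply: (proj2 kq).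
  exact: exact_at_kill (res_exact0 Q) at0 (proj1 cq).
- split.
    by apply: (kernel_mono kq); rewrite compA -de res_dd compm0.
  move=> T t td0; apply: (proj2 ce).
  exact: exact_at_kill (res_exact Q 0) dk0 td0.
Qed.

End Syzygy.

Section Degree1.
Variables (C : abelian) (E : allowable C).
Implicit Types X Y M N K : C.

Lemma cohomology_class1_eq0 X (P : resolution E X) M (a : cocycle P M 1) :
  cohomology_class a = 0 <->
  exists h : hom (P 0%N) M, cocycle_val a = h \oc res_d P 0.
Proof.
have <- : cohomology_class (0 : cocycle P M 1) = 0.
  exact: (raddf0 (\pi_(Quotient.quot (@is_coboundary C E X P M 1)))).
have classE : (cohomology_class a == cohomology_class 0) =
    (a \in @is_coboundary C E X P M 1) by rewrite -Quotient.idealrBE subr0.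
by split=> [/eqP|ha]; [|apply/eqP; move: ha]; rewrite classE inE => /asboolP.
Qed.

Lemma cohomology_class1_eq X (P : resolution E X) M (a b : cocycle P M 1) :
  cohomology_class a = cohomology_class b <->
  exists h : hom (P 0%N) M,
    cocycle_val a = cocycle_val b + h \oc res_d P 0.
Proof.
have classB : cohomology_class (a - b) = cohomology_class a - cohomology_class b.
  exact: (raddfB (\pi_(Quotient.quot (@is_coboundary C E X P M 1)))).
have -> : (cohomology_class a = cohomology_class b) <->
    cohomology_class (a - b) = 0.
  by rewrite classB; split=> [->|/subr0_eq //]; rewrite subrr.
rewrite cohomology_class1_eq0.
split=> -[h hE]; exists h; first by rewrite -hE addrC subrK.
by rewrite /= hE addrC addKr.
Qed.

Variables (X Y : C) (P : resolution E X) (Q : resolution E Y).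
Variables (K : C) (k : hom K (Q 0%N)) (e : hom (Q 1%N) K).
Hypothesis ke : is_syzygy k e.

Fact syzygy_cocycle_subproof : e \in @is_cocycle C E Y Q K 1.
Proof. by have [_ [ed0 _] _] := ke; rewrite inE ed0. Qed.

Definition syzygy_cocycle : cocycle Q K 1 := Cocycle syzygy_cocycle_subproof.

Lemma syzygy_generates M (x : cohomology Q M 1) :
  exists g : hom K M,
    x = fmap (cohomology_functor Q 1) g (cohomology_class syzygy_cocycle).
Proof.
elim/cohomologyW: x => a.
have [_ [_ ue] _] := ke.
have /eqP a0 : cocycle_val a \oc res_d Q 1 == 0 by have := cocycleP a; rewrite inE.
have [g [ge _]] := ue _ _ a0; exists g.
rewrite -[RHS]/(cohomology_map Q 1 g (cohomology_class syzygy_cocycle)).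
by rewrite cohomology_mapE; congr cohomology_class; apply: val_inj.
Qed.

(** A Yoneda argument: the functor is generated by the class of [e]. *)
Lemma nat_trans_syzygy (F : ab_functor C)
    (s t : nat_trans (cohomology_functor Q 1) F) :
  s K (cohomology_class syzygy_cocycle) = t K (cohomology_class syzygy_cocycle) ->
  s = t.
Proof.
move=> st; apply: nat_trans_ext => M x.
by have [g ->] := syzygy_generates x; rewrite !nt_natural st.
Qed.

(** The class vanishes because [k \oc e] is the first differential, the
    coboundary of the identity of [Q_0]. *)
Lemma syzygy_class_push :
  fmap (cohomology_functor Q 1) k (cohomology_class syzygy_cocycle) = 0.
Proof.
have [_ _ de] := ke.
rewrite -[LHS]/(cohomology_map Q 1 k (cohomology_class syzygy_cocycle)).
rewrite cohomology_mapE; apply/cohomology_class1_eq0; exists (idm (Q 0%N)).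
by rewrite /= comp1m de.
Qed.

Lemma chain_map_syzygy (f : hom X Y) (phi : chain_map P Q f) :
  k \oc (e \oc phi 1%N) = phi 0%N \oc res_d P 0.
Proof. by have [_ _ de] := ke; rewrite compA -de chain_d. Qed.

(** Both sides amount to the existence of [h : P_0 -> K] for which
    [phi 0 - psi 0 - k \oc h] vanishes on the syzygy of [X], hence is
    [t \oc res_aug P] for a lift [t] of [f - g]. *)
Lemma cohomology_nat_eq (f g : hom X Y)
    (phi : chain_map P Q f) (psi : chain_map P Q g) :
  cohomology_nat phi 1 = cohomology_nat psi 1 <-> stably_equivalent E f g.
Proof.
have [kk _ _] := ke; have [_ uk] := kk.
rewrite /stably_equivalent (factors_projectiveP Q); split=> [eqn|[t tE]].
  have : cohomology_nat phi 1 K (cohomology_class syzygy_cocycle) =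
      cohomology_nat psi 1 K (cohomology_class syzygy_cocycle) by rewrite eqn.
  rewrite !cohomology_natE => /cohomology_class1_eq[h /= hE].
  have d0 : (phi 0%N - psi 0%N - k \oc h) \oc res_d P 0 = 0.
    rewrite !compBl -!chain_map_syzygy hE compDr -compA.
    by rewrite addrAC addrK subrr.
  have [t [tE _]] := proj2 (res_aug_cokernel P) _ _ d0; exists t.
  apply: (res_epi P); rewrite compBl -(chain_aug phi) -(chain_aug psi) -compA.
  by rewrite tE !compBr (compA _ k) (proj1 kk) comp0m subr0.
have a0 : res_aug Q \oc (phi 0%N - psi 0%N - t \oc res_aug P) = 0.
  by rewrite !compBr !chain_aug compA -tE compBl subrr.
have [h [hE _]] := uk _ _ a0.
apply: nat_trans_syzygy; rewrite !cohomology_natE.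
apply/cohomology_class1_eq; exists h; apply: (kernel_mono kk).
rewrite /= compDr (compA k h) hE !chain_map_syzygy !compBl.
by rewrite -(compA t) res_aug_d compm0 subr0 addrC subrK.
Qed.

(** The value [c] of [theta] at the class of [e] satisfies
    [k \oc c = b \oc res_d P 0] for some [b], because [theta] preserves the
    vanishing in [syzygy_class_push]. The map [f] is the one that [b] induces on
    cokernels. *)
Lemma cohomology_nat_full
    (theta : nat_trans (cohomology_functor Q 1) (cohomology_functor P 1)) :
  exists f : hom X Y,
    forall phi : chain_map P Q f, cohomology_nat phi 1 = theta.
Proof.
have [kk _ _] := ke; have [ak0 uk] := kk.
have [c cE] : exists c : cocycle P K 1,
    theta K (cohomology_class syzygy_cocycle) = cohomology_class c.
  by elim/cohomologyW: (theta K _) => c; exists c.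
have := nt_natural theta k (cohomology_class syzygy_cocycle).
rewrite syzygy_class_push raddf0 cE.
rewrite -[RHS]/(cohomology_map P 1 k (cohomology_class c)) cohomology_mapE.
move=> /esym/cohomology_class1_eq0[b /= bE].
have ab0 : res_aug Q \oc b \oc res_d P 0 = 0.
  by rewrite -compA -bE compA ak0 comp0m.
have [f [fE _]] := proj2 (res_aug_cokernel P) _ _ ab0; exists f => phi.
have a0 : res_aug Q \oc (phi 0%N - b) = 0 by rewrite compBr chain_aug fE subrr.
have [h [hE _]] := uk _ _ a0.
apply: nat_trans_syzygy; rewrite cE cohomology_natE.
apply/cohomology_class1_eq; exists h; apply: (kernel_mono kk).
by rewrite /= compDr (compA k h) hE chain_map_syzygy bE compBl addrC subrK.
Qed.

End Degree1.

Section ExtMap.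
Variables (C : abelian) (E : allowable C) (enough : enough_projectives E).
Implicit Types X Y : C.

Lemma Ext_map1_eq X Y (f g : hom X Y) :
  Ext_map enough 1 f = Ext_map enough 1 g <-> stably_equivalent E f g.
Proof.
have [K [k [e ke]]] := syzygy_exists (proj_res enough Y).
exact: cohomology_nat_eq ke _ _ _ _.
Qed.

Lemma Ext_map1_full X Y (theta : nat_trans (Ext enough 1 Y) (Ext enough 1 X)) :
  exists f : hom X Y, Ext_map enough 1 f = theta.
Proof.
have [K [k [e ke]]] := syzygy_exists (proj_res enough Y).
by have [f fE] := cohomology_nat_full ke theta; exists f; exact: fE.
Qed.

(** The representative is immaterial, by [Ext_map1_eq]. *)
Definition stable_Ext_map X Y (x : stable_hom E X Y) :
    nat_trans (Ext enough 1 Y) (Ext enough 1 X) :=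
  Ext_map enough 1 (repr (x : Quotient.quot (@stably_zero C E X Y))).

Lemma stable_Ext_mapE X Y (f : hom X Y) :
  stable_Ext_map (stable_class E f) = Ext_map enough 1 f.
Proof. by apply/Ext_map1_eq/stable_classP; rewrite /stable_class reprK. Qed.

Lemma stable_Ext_map_bij X Y : bijective (@stable_Ext_map X Y).
Proof.
pose f theta : hom X Y := sval (cid (Ext_map1_full theta)).
have fE theta : Ext_map enough 1 (f theta) = theta
  by exact: svalP (cid (Ext_map1_full theta)).
exists (fun theta => stable_class E (f theta)) => [x|theta].
  elim/quotW: x => g; rewrite -[\pi_ _ g]/(stable_class E g).
  by apply/stable_classP/Ext_map1_eq; rewrite fE stable_Ext_mapE.
by rewrite stable_Ext_mapE fE.
Qed.

End ExtMap.

Theorem lemma3p6 (C : abelian) (E : allowable C)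
    (enough : enough_projectives E) :
  exists Phi : forall X Y : C,
      stable_hom E X Y -> nat_trans (Ext enough 1 Y) (Ext enough 1 X),
    (forall X Y : C, bijective (Phi X Y)) /\
    (forall (X X' Y Y' : C) (u : hom X' X) (v : hom Y Y') (f : hom X Y),
      Phi X' Y' (stable_class E (v \oc f \oc u)) =
      nt_comp (Ext_map enough 1 u)
        (nt_comp (Phi X Y (stable_class E f)) (Ext_map enough 1 v))).
Proof.
exists (stable_Ext_map enough); split=> [X Y|X X' Y Y' u v f].
  exact: stable_Ext_map_bij.
by rewrite !stable_Ext_mapE !Ext_map_comp.
Qed.
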